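(* For a monoid $S$ the following are equivalent: (i) the equational theory $Eq(S)$ is the set of all block-balanced identities; (ii) $S$ is finitely based by $\{\sigma_1,\sigma_\mu,\sigma_2\}^\delta$ (i.e. this set is a basis for the identities of $S$); (iii) $S$ is equationally equivalent to $S(W_{AL})$, where $W_{AL}$ is the set of all almost-linear words.
   Context: Variables are elements of a countable alphabet $\mathfrak A$, words are elements of the free semigroup $\mathfrak A^+$; an identity is $\mathbf u\approx\mathbf v$ with $\mathbf u,\mathbf v$ words. Monoids are regarded as semigroups: $Eq(S)$ is the set of all semigroup identities holding in $S$, a basis is a set of identities of $S$ from which all of $Eq(S)$ can be derived in the equational logic of semigroups, and two semigroups are equationally equivalent if they satisfy the same identities. $\sigma_\mu$ is $xt_1xyt_2y\approx xt_1yxt_2y$; $\sigma_1$ is $xyt_1xt_2y\approx yxt_1xt_2y$; $\sigma_2$ is $xt_1yt_2xy\approx xt_1yt_2yx$. For a set $\mathfrak X$ of variables, $\mathbf u(\mathfrak X)$ is the word obtained from $\mathbf u$ by deleting all occurrences of variables not in $\mathfrak X$; $\mathbf u(x,\mathfrak Y)=\mathbf u(\{x\}\cup\mathfrak Y)$. $\Sigma^\delta$ is the closure of $\Sigma$ under deleting variables: all identities $\mathbf u(\mathfrak X)\approx\mathbf v(\mathfrak X)$ with $(\mathbf u\approx\mathbf v)\in\Sigma$ and $\mathfrak X$ a set of variables. A variable is linear in a word if it occurs in it exactly once and non-linear if it occurs more than once; $\mathrm{Lin}(\mathbf u)$ is the set of linear variables of $\mathbf u$. A word is almost-linear if it contains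 at most one non-linear variable. An identity $\mathbf u\approx\mathbf v$ is block-balanced if $\mathbf u(x,\mathrm{Lin}(\mathbf u))=\mathbf v(x,\mathrm{Lin}(\mathbf u))$ for every variable $x$. For a set of words $W$, $S(W)$ denotes the Rees quotient of the free monoid $\mathfrak A^*$ over the ideal consisting of all words that are not subwords (contiguous factors) of words in $W$. *)

(* Defs.v *)
From HB Require Import structures.
From mathcomp Require Import all_boot.
From mathcomp Require Import boolp classical_sets.

Set Implicit Arguments.
Unset Strict Implicit.
Unset Printing Implicit Defensive.

Local Open Scope group_scope.
Local Open Scope quotient_scope.
Local Open Scope classical_set_scope.

(* The alphabet is [nat]; the free monoid on it is [seq nat] with
   concatenation, and the free semigroup is the type [word] of nonempty
   sequences. *)
Record word := Word { letters :> seq nat; _ : letters != [::] }.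

HB.instance Definition _ := [isSub for letters].
HB.instance Definition _ := [Choice of word by <:].

Fact wcat_subproof (u v : word) : letters u ++ letters v != [::].
Proof. by case: u => [[|a s]]. Qed.

Definition wcat (u v : word) : word := Word (wcat_subproof u v).

Fact wcatA : associative wcat.
Proof. by move=> u v w; apply: val_inj; rewrite /= catA. Qed.

HB.instance Definition _ := isSemigroup.Build word wcatA.

(* The value of a word under an assignment [phi] of its variables, that is,
   the image of [u] under the homomorphism from the free semigroup to [T]
   extending [phi].  As [u] is nonempty, the default [0%N] of [head] is never
   used. *)
Definition eval (T : semigroupType) (phi : nat -> T) (u : word) : T :=
  foldl (fun a x => a * phi x) (phi (head 0%N (letters u)))
        (behead (letters u)).

(* The pair [(u, v)] stands for the identity u ≈ v. *)
Definition identity : Type := (word * word)%type.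

Definition eq_theory (T : semigroupType) : set identity :=
  [set e | forall phi : nat -> T, eval phi e.1 = eval phi e.2].

Definition equationally_equivalent (T1 T2 : semigroupType) : Prop :=
  eq_theory T1 = eq_theory T2.

(* Equational logic of semigroups: words are taken modulo associativity, so the
   rule for the binary operation symbol is compatibility with concatenation.
   Since [word] is itself a semigroup, [eval phi] with [phi : nat -> word] is
   substitution. *)
Inductive derivable (Sigma : set identity) : word -> word -> Prop :=
| derivable_ax u v : Sigma (u, v) -> derivable Sigma u v
| derivable_refl u : derivable Sigma u u
| derivable_sym u v : derivable Sigma u v -> derivable Sigma v u
| derivable_trans u v w :
    derivable Sigma u v -> derivable Sigma v w -> derivable Sigma u w
| derivable_subst (phi : nat -> word) u v :
    derivable Sigma u v -> derivable Sigma (eval phi u) (eval phi v)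
| derivable_mul u v u' v' :
    derivable Sigma u v -> derivable Sigma u' v' ->
    derivable Sigma (u * u') (v * v').

Definition is_basis (T : semigroupType) (Sigma : set identity) : Prop :=
  Sigma `<=` eq_theory T /\
  forall u v, eq_theory T (u, v) -> derivable Sigma u v.

(* u(X): the result may be the empty word, hence the type [seq nat]. *)
Definition restrict (X : pred nat) (u : seq nat) : seq nat :=
  [seq x <- u | X x].

(* Only pairs of nonempty words are identities, so a deletion that empties a
   side contributes nothing. *)
Definition delta (Sigma : set identity) : set identity :=
  [set e | exists u v (X : pred nat),
     [/\ Sigma (u, v), letters e.1 = restrict X u
       & letters e.2 = restrict X v]].

(* Here x, y, t1, t2 are the variables 0, 1, 2, 3. *)
(* x t1 x y t2 y ≈ x t1 y x t2 y *)
Definition sigma_mu : identity :=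
  (@Word [:: 0; 2; 0; 1; 3; 1]%N isT, @Word [:: 0; 2; 1; 0; 3; 1]%N isT).
(* x y t1 x t2 y ≈ y x t1 x t2 y *)
Definition sigma_1 : identity :=
  (@Word [:: 0; 1; 2; 0; 3; 1]%N isT, @Word [:: 1; 0; 2; 0; 3; 1]%N isT).
(* x t1 y t2 x y ≈ x t1 y t2 y x *)
Definition sigma_2 : identity :=
  (@Word [:: 0; 2; 1; 3; 0; 1]%N isT, @Word [:: 0; 2; 1; 3; 1; 0]%N isT).

Definition linear (u : seq nat) : pred nat := fun x => count_mem x u == 1%N.

Definition nonlinear (u : seq nat) : pred nat := fun x => 1 < count_mem x u.

Definition almost_linear (u : word) : Prop :=
  forall x y, nonlinear u x -> nonlinear u y -> x = y.

Definition block_balanced (e : identity) : Prop :=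
  forall x, restrict [predU1 x & linear e.1] e.1
          = restrict [predU1 x & linear e.1] e.2.

Section Rees.
Variable W : set word.

Definition factor_of (w : seq nat) : Prop :=
  exists2 u : word, W u & infix w u.

(* The ideal of [seq nat] collapsed in S(W). *)
Definition rees_ideal : set (seq nat) := [set w | ~ factor_of w].

Lemma rees_ideal_cat (a w b : seq nat) :
  rees_ideal w -> rees_ideal (a ++ w ++ b).
Proof.
move=> nw [u Wu /infixP[p [s eu]]]; apply: nw; exists u => //.
by apply/infixP; exists (p ++ a), (b ++ s); rewrite eu !catA.
Qed.

Definition rees_rel (u v : seq nat) : bool :=
  (u == v) || `[< rees_ideal u /\ rees_ideal v >].

Fact rees_rel_refl : reflexive rees_rel.
Proof. by move=> u; rewrite /rees_rel eqxx. Qed.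

Fact rees_rel_sym : symmetric rees_rel.
Proof.
by move=> u v; rewrite /rees_rel eq_sym; congr orb; apply/asboolP/asboolP; case.
Qed.

Fact rees_rel_trans : transitive rees_rel.
Proof.
move=> v u w /orP[/eqP->//|/asboolP[Iu Iv]] /orP[/eqP<-|/asboolP[_ Iw]];
by apply/orP; right; apply/asboolP.
Qed.

Canonical rees_equiv :=
  EquivRel rees_rel rees_rel_refl rees_rel_sym rees_rel_trans.

(* S(W) *)
Definition rees := {eq_quot rees_equiv}.

HB.instance Definition _ := Choice.on rees.
HB.instance Definition _ := EqQuotient.on rees.

Lemma rees_piP (u v : seq nat) : reflect (\pi_rees u = \pi_rees v) (rees_rel u v).
Proof. exact: eqmodP. Qed.

Definition rees_one : rees := \pi_rees [::].
Definition rees_mul (a b : rees) : rees := \pi_rees (repr a ++ repr b).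

Lemma rees_mul_pi (u v : seq nat) :
  rees_mul (\pi_rees u) (\pi_rees v) = \pi_rees (u ++ v).
Proof.
have E w : rees_rel (repr (\pi_rees w)) w by apply/rees_piP; rewrite reprK.
have R (a b c d : seq nat) : rees_rel a c -> rees_rel b d ->
    rees_rel (a ++ b) (c ++ d).
  have I1 w t : rees_ideal w -> rees_ideal (w ++ t) by exact: (@rees_ideal_cat [::]).
  have I2 w t : rees_ideal w -> rees_ideal (t ++ w).
    by move=> /(@rees_ideal_cat t w [::]); rewrite cats0.
  move=> /orP[/eqP->|/asboolP[Ia Ic]] /orP[/eqP->|/asboolP[Ib Id]];
    first exact: rees_rel_refl;
    by apply/orP; right; apply/asboolP; split; auto.
by apply/rees_piP; apply: R; apply: E.
Qed.

Fact rees_mulA : associative rees_mul.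
Proof.
elim/quotW=> u; elim/quotW=> v; elim/quotW=> w.
by rewrite (rees_mul_pi v w) (rees_mul_pi u v) !rees_mul_pi catA.
Qed.

Fact rees_mul1 : left_id rees_one rees_mul.
Proof. by elim/quotW=> u; rewrite rees_mul_pi. Qed.

Fact rees_mulr1 : right_id rees_one rees_mul.
Proof. by elim/quotW=> u; rewrite rees_mul_pi cats0. Qed.

HB.instance Definition _ := isMonoid.Build rees rees_mulA rees_mul1 rees_mulr1.
End Rees.

(* Main.v *)
Require Import Defs.
From mathcomp Require Import all_boot.
From mathcomp Require Import boolp classical_sets.

(** Write [u] as blocks of non-linear letters separated by the linear ones.  An
    identity is block-balanced exactly when its two sides are connected by
    transpositions of adjacent non-linear letters.  Such a transposition
    [p x y s ~ p y x s] is an instance of (a deletion of) [sigma_1], [sigma_mu]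
    or [sigma_2], according to whether the other occurrences of [x] and [y] lie
    in [p] or in [s]; hence block-balanced identities are derivable.  It also
    holds in S(W_AL): a substitution either sends [x] and [y] to powers of one
    letter, which commute, or produces two distinct non-linear letters, so that
    both sides are zero.  Conversely, an identity of S(W_AL) is block-balanced
    because each word [u(x, Lin(u))] is itself almost-linear. *)

Set Implicit Arguments.
Unset Strict Implicit.
Unset Printing Implicit Defensive.

Local Open Scope group_scope.
Local Open Scope quotient_scope.

(** * Substitution of possibly empty words *)

Definition seq_subst (theta : nat -> seq nat) (s : seq nat) : seq nat :=
  flatten [seq theta x | x <- s].

Lemma seq_subst_cat theta s t :
  seq_subst theta (s ++ t) = seq_subst theta s ++ seq_subst theta t.
Proof. by rewrite /seq_subst map_cat flatten_cat. Qed.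

Lemma seq_subst_restrict theta s :
  seq_subst theta (restrict [pred z | theta z != [::]] s) = seq_subst theta s.
Proof.
rewrite /seq_subst /restrict; elim: s => //= a s IHs.
by case: eqP => [->|_] /=; rewrite IHs.
Qed.

Lemma eval_morphism (T : semigroupType) (f : seq nat -> T)
    (theta : nat -> seq nat) (u : word) :
  {morph f : s t / s ++ t >-> s * t} ->
  eval (f \o theta) u = f (seq_subst theta u).
Proof.
move=> fM; case: u => [[|a s] //= u_neq0]; rewrite /eval /seq_subst /=.
elim: s (theta a) => [|b s IHs] w /=; first by rewrite cats0.
by rewrite -fM IHs catA.
Qed.

Lemma eval_mul (T : semigroupType) (phi : nat -> T) (u v : word) :
  eval phi (u * v) = eval phi u * eval phi v.
Proof.
case: u v => [[|a s] //= nu] [[|b t] //= nv]; rewrite /eval /= foldl_cat /=.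
by elim: t (phi b) {nv} => //= c t IHt w; rewrite -mulgA IHt.
Qed.

Lemma eval_eval (T : semigroupType) (phi : nat -> T) (psi : nat -> word)
    (u : word) :
  eval phi (eval psi u) = eval (fun x => eval phi (psi x)) u.
Proof.
case: u => [[|a s] // nu].
rewrite -[eval psi _]/(foldl _ (psi a) s) -[RHS]/(foldl _ (eval phi (psi a)) s) {nu}.
by elim: s (psi a) => //= b s IHs w; rewrite IHs eval_mul.
Qed.

Lemma letters_eval (phi : nat -> word) (u : word) :
  letters (eval phi u) = seq_subst (letters \o phi) u.
Proof.
case: u => [[|a s] //= nu]; rewrite /eval /seq_subst /= {nu}.
elim: s (phi a) => [|b s IHs] w /=; first by rewrite cats0.
by rewrite IHs /= catA.
Qed.

Lemma derivable_sound (T : semigroupType) (Sigma : set identity) u v :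
  (Sigma `<=` eq_theory T)%classic -> derivable Sigma u v ->
  eq_theory T (u, v).
Proof.
move=> sub; elim=> {u v}.
- by move=> u v /sub.
- by [].
- by move=> u v _ IH phi; rewrite /= (IH phi).
- by move=> u v w _ IH1 _ IH2 phi; rewrite /= (IH1 phi) (IH2 phi).
- by move=> psi u v _ IH phi; rewrite /= !eval_eval; apply: IH.
- by move=> u v u' v' _ IH1 _ IH2 phi; rewrite /= !eval_mul (IH1 phi) (IH2 phi).
Qed.

(** * Block-balanced identities as chains of transpositions *)

Lemma linear_perm s t : perm_eq s t -> linear s =1 linear t.
Proof. by move=> /permP st x; rewrite /linear st. Qed.

Lemma mem_neq_linear s x : x \in s -> ~~ linear s x -> nonlinear s x.
Proof.
by rewrite -has_pred1 has_count /linear /nonlinear; case: count => [|[]].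
Qed.

Section Swaps.
(** [P] is used twice: as derivability from the basis, and as equality in S(W_AL) of the images
    under a fixed substitution. *)
Variable P : seq nat -> seq nat -> Prop.
Hypothesis P_refl : forall s, P s s.
Hypothesis P_trans : forall s t r, P s t -> P t r -> P s r.
Hypothesis P_swap : forall p s x y,
  nonlinear (p ++ x :: y :: s) x -> nonlinear (p ++ x :: y :: s) y ->
  P (p ++ x :: y :: s) (p ++ y :: x :: s).

Lemma swap_to_front p t c s :
  {in c :: t, forall z, ~~ linear (p ++ t ++ c :: s) z} ->
  P (p ++ t ++ c :: s) (p ++ c :: t ++ s).
Proof.
elim/last_ind: t s => [|t d IHt] s nlin /=; first exact: P_refl.
have in_nl z : z \in [:: c; d] ->
    nonlinear ((p ++ t) ++ d :: c :: s) z.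
  move=> zcd; apply: mem_neq_linear.
    by move: zcd; rewrite mem_cat !inE => /orP[]->; rewrite ?orbT.
  move: (nlin z); rewrite cat_rcons -catA; apply.
  by move: zcd; rewrite !inE mem_rcons inE => /orP[]->; rewrite ?orbT.
rewrite !cat_rcons; apply: (@P_trans _ ((p ++ t) ++ c :: d :: s)).
  by rewrite (catA p); apply: P_swap; apply: in_nl; rewrite !inE eqxx ?orbT.
rewrite -catA; apply: IHt => z zt.
rewrite (@linear_perm _ (p ++ rcons t d ++ c :: s)).
  by apply: nlin; move: zt; rewrite !inE mem_rcons inE => /orP[]->; rewrite ?orbT.
by rewrite cat_rcons !perm_cat2l (perm_catCA [:: c] [:: d]).
Qed.

(** Induction on the target [s], with [p] the prefix already matched: the next letter [c] of [s] is
    brought to the front of [t]. [L] records linearity in the whole word, since a letter of [p] may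
    occur just once in [t] without being linear. *)
Lemma block_balanced_swap_aux (L : pred nat) p s t :
  linear (p ++ t) =1 L ->
  (forall x, restrict [predU1 x & L] t = restrict [predU1 x & L] s) ->
  P (p ++ t) (p ++ s).
Proof.
elim: s p t => [|c s IHs] p t linL bal.
  case: t linL bal => [|d t] _ bal; first exact: P_refl.
  by have := bal d; rewrite /restrict /= eqxx.
have ct : c \in t.
  have : c \in restrict [predU1 c & L] t by rewrite bal mem_filter !inE !eqxx.
  by rewrite mem_filter => /andP[].
have [t1 [t2 [def_t ct1]]] : exists t1 t2, t = t1 ++ c :: t2 /\ c \notin t1.
  elim: t {linL bal} ct => // d t IHt; have [<- _|neq_cd] := eqVneq c d.
    by exists [::], t.
  rewrite inE (negPf neq_cd) /= => /IHt[t1 [t2 [-> ct1]]].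
  by exists (d :: t1), t2; rewrite inE negb_or neq_cd.
rewrite {}def_t {t ct} in linL bal *.
(* Once both suffixes start with [c], this letter joins the prefix. *)
have advance t : perm_eq (c :: t) (t1 ++ c :: t2) ->
    (forall x, restrict [predU1 x & L] t = restrict [predU1 x & L] s) ->
  P (p ++ c :: t) (p ++ c :: s).
  move=> pt bal_t; rewrite -!cat_rcons; apply: IHs => // x.
  by rewrite -linL; apply: linear_perm; rewrite cat_rcons perm_cat2l.
case: t1 => [|d t1] in linL bal ct1 advance *.
  apply: advance => // x; have := bal x.
  by rewrite /restrict /=; case: ifP => // _ [].
have /norP[/= neq_cd ct1'] : ~~ ((c == d) || (c \in t1)) by rewrite -in_cons.
(* Restricting to [d] and [L], the left side starts with [d]; were [c] linear, the right side would
   start with [c]. *)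
have Lc : c \notin L.
  apply/negP => Lc; have := bal d; rewrite /restrict /= eqxx Lc orbT.
  by case=> eq_dc; rewrite eq_dc eqxx in neq_cd.
(* Restricting to [c] and [L], the right side starts with [c], which does not occur in [d :: t1]; so
   nothing of [d :: t1] survives, and it has no linear letter. *)
have t1_0 : restrict [predU1 c & L] (d :: t1) = [::].
  have := bal c; rewrite /restrict filter_cat /= !eqxx /= -/(filter _ (d :: t1)).
  case def_f: (filter _ (d :: t1)) => [//|e f] [eq_ec].
  have : e \in filter [predU1 c & L] (d :: t1) by rewrite def_f mem_head.
  by rewrite eq_ec mem_filter (negPf ct1) andbF.
have Lt1 z : z \in d :: t1 -> z \notin L.
  move=> zt; apply/negP => Lz.
  have : z \in restrict [predU1 c & L] (d :: t1).
    by rewrite mem_filter zt inE /= Lz orbT.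
  by rewrite t1_0.
apply: (@P_trans _ (p ++ c :: (d :: t1) ++ t2)).
  apply: (@swap_to_front p (d :: t1)) => z; rewrite inE linL.
  by case/predU1P => [->//|/Lt1].
apply: advance => [|x]; first by rewrite perm_sym (perm_catCA (d :: t1) [:: c]).
have restrict_cat r1 r2 : restrict [predU1 x & L] (r1 ++ r2) =
    restrict [predU1 x & L] r1 ++ restrict [predU1 x & L] r2 := filter_cat _ _ _.
(* For [x = c] the jumped block is erased; for any other [x] the letter [c] is erased. *)
have := bal x; rewrite !restrict_cat; have [<-|neq_xc] := eqVneq c x.
  by rewrite t1_0 /= !eqxx => -[].
by rewrite /restrict /= (negPf Lc) (negPf neq_xc).
Qed.

Lemma block_balanced_swap (e : identity) : block_balanced e -> P e.1 e.2.
Proof. exact: (@block_balanced_swap_aux _ [::]). Qed.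
End Swaps.

(** * Derivability from the basis *)

Section Derivability.
Variable Sigma : set identity.

(* Derivability between possibly empty words, the empty one being derivable
   only from itself. *)
Definition derivable_seq (s t : seq nat) : Prop :=
  s = t \/ exists u v : word, [/\ letters u = s, letters v = t & derivable Sigma u v].

Lemma derivable_seq_trans s t r :
  derivable_seq s t -> derivable_seq t r -> derivable_seq s r.
Proof.
case=> [->//|[u [v [eu ev uv]]]] [<-|[v' [w [ev' ew vw]]]]; right.
  by exists u, v.
exists u, w; split=> //; apply: derivable_trans uv _.
by have -> : v = v' by apply: val_inj; rewrite /= ev ev'.
Qed.

Lemma derivable_seq_sym s t : derivable_seq s t -> derivable_seq t s.
Proof.
case=> [->|[u [v [eu ev uv]]]]; [by left | right].
by exists v, u; split=> //; apply: derivable_sym.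
Qed.

Lemma derivable_seq_ctx p s t r :
  derivable_seq s t -> derivable_seq (p ++ s ++ r) (p ++ t ++ r).
Proof.
case=> [->|[u [v [<- <- uv]]]]; first by left.
have {uv} [u' [v' [<- <- uv]]] : exists u' v' : word,
    [/\ letters u' = u ++ r, letters v' = v ++ r & derivable Sigma u' v'].
  case: r => [|a r]; first by exists u, v; rewrite !cats0.
  exists (u * Word (isT : a :: r != [::])), (v * Word (isT : a :: r != [::])).
  by split=> //; apply: derivable_mul => //; apply: derivable_refl.
right; case: p => [|a p]; first by exists u', v'.
exists (Word (isT : a :: p != [::]) * u'), (Word (isT : a :: p != [::]) * v').
by split=> //; apply: derivable_mul => //; apply: derivable_refl.
Qed.

Lemma derivable_seqE (u v : word) : derivable_seq u v -> derivable Sigma u v.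
Proof.
case=> [/val_inj->|[u' [v' [eu ev uv]]]]; first exact: derivable_refl.
by rewrite -(val_inj eu : u' = u) -(val_inj ev : v' = v).
Qed.
End Derivability.

(* Closure under deletion is what allows substituting the empty word. *)
Lemma derivable_seq_delta (Sigma : set identity) (u v : word)
    (theta : nat -> seq nat) :
  Sigma (u, v) -> seq_subst theta u != [::] -> seq_subst theta v != [::] ->
  derivable_seq (delta Sigma) (seq_subst theta u) (seq_subst theta v).
Proof.
move=> Suv; rewrite -(seq_subst_restrict theta u) -(seq_subst_restrict theta v).
set X := [pred z | _] => nu nv.
have ru : restrict X u != [::] by apply: contraNneq nu => ->.
have rv : restrict X v != [::] by apply: contraNneq nv => ->.
(* The default word is taken only at letters that [theta] erases, and [X] deletes these. *)
pose phi z := insubd (Word (isT : [:: 0%N] != [::])) (theta z).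
have phiE (w : seq nat) :
    seq_subst (letters \o phi) (restrict X w) = seq_subst theta (restrict X w).
  rewrite /seq_subst; congr flatten; apply/eq_in_map => z.
  rewrite mem_filter => /andP[Xz _] /=.
  by rewrite -[letters _]/(val _) val_insubd -[_ != _]/(X z) Xz.
right; exists (eval phi (Word ru)), (eval phi (Word rv)).
split; rewrite ?letters_eval ?phiE //.
by apply: derivable_subst; apply: derivable_ax; exists u, v, X.
Qed.

Lemma nonlinear_swap_mem p s x y :
  x != y -> nonlinear (p ++ x :: y :: s) x -> (x \in p) || (x \in s).
Proof.
rewrite /nonlinear count_cat /= eqxx eq_sym => /negPf->.
by rewrite -!has_pred1 !has_count addnCA ltnS add0n addn_gt0.
Qed.

Lemma derivable_seq_swap p s x y :
  nonlinear (p ++ x :: y :: s) x -> nonlinear (p ++ x :: y :: s) y ->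
  derivable_seq (delta [set sigma_1; sigma_mu; sigma_2]%classic)
    (p ++ x :: y :: s) (p ++ y :: x :: s).
Proof.
have [->|neq_xy] := eqVneq x y; first by left.
move=> nx ny.
have {nx} xps := nonlinear_swap_mem neq_xy nx.
have {ny} yps : (y \in p) || (y \in s).
  rewrite eq_sym in neq_xy; apply: (nonlinear_swap_mem neq_xy).
  by move: ny; rewrite /nonlinear !count_cat /= [X in (_ + X)%N]addnCA.
set D := derivable_seq _.
(* The list follows the numbering 0, 1, 2, 3 of x, y, t1, t2 in the three identities. *)
pose th (a b : nat) (t1 t2 : seq nat) z := nth [::] [:: [:: a]; [:: b]; t1; t2] z.
have by_sigma (e : identity) a b t1 t2 : [set sigma_1; sigma_mu; sigma_2]%classic e ->
    D (seq_subst (th a b t1 t2) e.1) (seq_subst (th a b t1 t2) e.2).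
  move=> Se; apply: (@derivable_seq_delta _ e.1 e.2); first by case: e Se.
    by case: Se => [[]|] ->.
  by case: Se => [[]|] ->.
have sym s1 s2 : D s1 s2 -> D s2 s1 by apply: derivable_seq_sym.
have ctx q r s1 s2 : D s1 s2 -> D (q ++ s1 ++ r) (q ++ s2 ++ r).
  by apply: derivable_seq_ctx.
have s1P a b t1 t2 : D ([:: a; b] ++ t1 ++ a :: t2 ++ [:: b])
                       ([:: b; a] ++ t1 ++ a :: t2 ++ [:: b]).
  by apply: (by_sigma sigma_1); left; left.
have smP a b t1 t2 : D (a :: t1 ++ [:: a; b] ++ t2 ++ [:: b])
                       (a :: t1 ++ [:: b; a] ++ t2 ++ [:: b]).
  by apply: (by_sigma sigma_mu); left; right.
have s2P a b t1 t2 : D (a :: t1 ++ b :: t2 ++ [:: a; b])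
                       (a :: t1 ++ b :: t2 ++ [:: b; a]).
  by apply: (by_sigma sigma_2); right.
have [xp|/negPf xp] := boolP (x \in p); have [yp|/negPf yp] := boolP (y \in p).
(* Each identity prescribes the order of the two outer occurrences. For the opposite order [x] and
   [y] exchange roles and the instance is read backwards. *)
- case/splitPr: xp yp => p1 p2; rewrite mem_cat inE eq_sym (negPf neq_xy) /=.
  case/orP => /splitPr[q1 q2].
    have /sym := ctx q1 s _ _ (s2P y x q2 p2).
    by rewrite /= -?catA /= -?catA.
  by have := ctx p1 s _ _ (s2P x y q1 q2); rewrite /= -?catA /= -?catA.
- rewrite yp /= in yps; case/splitPr: xp => p1 p2; case/splitPr: yps => q1 q2.
  by have := ctx p1 q2 _ _ (smP x y p2 q1); rewrite /= -?catA /= -?catA.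
- rewrite xp /= in xps; case/splitPr: yp => p1 p2; case/splitPr: xps => q1 q2.
  by have /sym := ctx p1 q2 _ _ (smP y x p2 q1); rewrite /= -?catA /= -?catA.
rewrite xp yp /= in xps yps.
case/splitPr: xps yps => p1 p2; rewrite mem_cat inE eq_sym (negPf neq_xy) /=.
case/orP => /splitPr[q1 q2].
  have /sym := ctx p p2 _ _ (s1P y x q1 q2).
  by rewrite /= -?catA /= -?catA.
by have := ctx p q2 _ _ (s1P x y p1 q1); rewrite /= -?catA /= -?catA.
Qed.

Local Notation basis := (delta [set sigma_1; sigma_mu; sigma_2]%classic).

Lemma block_balanced_derivable (u v : word) :
  block_balanced (u, v) -> derivable basis u v.
Proof.
move=> bal; apply: derivable_seqE.
apply: (block_balanced_swap _ _ _ bal); first by left.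
  exact: derivable_seq_trans.
exact: derivable_seq_swap.
Qed.

(** Deletion does not change how often a remaining letter occurs, so it preserves linearity and
    commutes with the restrictions to be compared. *)
Lemma delta_block_balanced (Sigma : set identity) :
  (Sigma `<=` [set e | block_balanced e])%classic ->
  (delta Sigma `<=` [set e | block_balanced e])%classic.
Proof.
move=> sub [u' v'] [u [v [X [/sub bal /= eu ev]]]] x /=.
have linE z : X z -> (z \in linear u') = (z \in linear u).
  move=> Xz; rewrite -!topredE /= /linear eu count_filter.
  by congr (_ == _); apply: eq_count => t /=; case: eqP => [->|].
have E (w : seq nat) : restrict [predU1 x & linear u'] (restrict X w) =
    restrict X (restrict [predU1 x & linear u] w).
  rewrite /restrict -!filter_predI; apply: eq_in_filter => z _ /=.
  by have [/linE->|] := boolP (X z); rewrite ?andbT ?andbF.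
by move: (E u) (E v); rewrite -eu -ev => -> ->; rewrite bal.
Qed.

Lemma basis_block_balanced : (basis `<=` [set e | block_balanced e])%classic.
Proof.
by apply: delta_block_balanced => e [[]|] -> [|[|x]] //=; case: x => [|[]].
Qed.

(** * Identities of S(W_AL) *)

(** All letters are compared with the head of [s]: if they agree, both words are powers of it. *)
Lemma cat_comm_or_neq (T : eqType) (s t : seq T) :
  s ++ t = t ++ s \/ exists a b, [/\ a \in s, b \in t & a != b].
Proof.
case: s => [|a s]; first by left; rewrite cats0.
have [/all_pred1P ->|/allPn[b bt ba]] := boolP (all (pred1 a) t); last first.
  by right; exists a, b; rewrite mem_head eq_sym.
have [/all_pred1P ->|/allPn[b bs ba]] := boolP (all (pred1 a) (a :: s)).
  by left; rewrite !cat_nseq /ncons -!iterD addnC.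
case: (size t) => [|n]; first by left; rewrite cats0.
by right; exists b, a; rewrite bs mem_head.
Qed.

Lemma nonlinear_subst theta s x a :
  nonlinear s x -> a \in theta x -> nonlinear (seq_subst theta s) a.
Proof.
rewrite /nonlinear -has_pred1 has_count => ltx lta; apply: leq_trans ltx _.
rewrite /seq_subst; elim: s => //= z s IHs; rewrite count_cat leq_add //.
by case: eqP => [->|].
Qed.

Local Notation W_AL := [set w | almost_linear w]%classic.

(** A letter non-linear in a factor is non-linear in the whole word. *)
Lemma rees_ideal_W_AL s a b :
  nonlinear s a -> nonlinear s b -> a != b -> rees_ideal W_AL s.
Proof.
move=> na nb /eqP neq_ab [u ALu /infixP[p [r eu]]]; apply: neq_ab.
have inc z : nonlinear s z -> nonlinear u z.
  move=> /leq_trans; apply; rewrite eu !count_cat.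
  by rewrite (leq_trans (leq_addr _ _) (leq_addl _ _)).
by apply: ALu; apply: inc.
Qed.

Lemma not_rees_ideal_W_AL s :
  (forall x y, nonlinear s x -> nonlinear s y -> x = y) -> ~ rees_ideal W_AL s.
Proof.
move=> ALs; apply; case: s ALs => [|a s] ALs.
  (* The empty sequence is not a [word], but it is a factor of a one-letter word. *)
  by exists (@Word [:: 0] isT) => //= -[|x] [|y].
by exists (Word (isT : a :: s != [::])); [exact: ALs | rewrite infix_refl].
Qed.

Lemma rees_rel_swap theta p s x y :
  nonlinear (p ++ x :: y :: s) x -> nonlinear (p ++ x :: y :: s) y ->
  rees_rel W_AL (seq_subst theta (p ++ x :: y :: s))
                (seq_subst theta (p ++ y :: x :: s)).
Proof.
set w := p ++ x :: y :: s; set w' := p ++ y :: x :: s => nx ny.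
have pww' : perm_eq w w' by rewrite perm_cat2l (perm_catCA [:: x] [:: y]).
have [comm|[a [b [ax bY neq_ab]]]] := cat_comm_or_neq (theta x) (theta y).
  suff -> : seq_subst theta w = seq_subst theta w' by apply: rees_rel_refl.
  by rewrite !seq_subst_cat /seq_subst /= !catA -(catA _ (theta x)) comm !catA.
apply/orP; right; apply/asboolP.
have nl z : nonlinear w z -> nonlinear w' z.
  by rewrite /nonlinear (permP pww').
split; apply: (@rees_ideal_W_AL _ a b) => //.
- exact: nonlinear_subst nx ax.
- exact: nonlinear_subst ny bY.
- exact: nonlinear_subst (nl _ nx) ax.
- exact: nonlinear_subst (nl _ ny) bY.
Qed.

Lemma eval_rees (W : set word) theta (u : word) :
  eval (fun x => \pi_(rees W) (theta x)) u = \pi_(rees W) (seq_subst theta u).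
Proof.
by apply: (@eval_morphism (rees W) (fun s => \pi_(rees W) s)) => s t;
  rewrite -rees_mul_pi.
Qed.

Lemma eq_theory_rees_W_AL :
  eq_theory (rees W_AL) = [set e | block_balanced e]%classic.
Proof.
apply/seteqP; split=> [[u v] /= eq_uv x|[u v] bal phi] /=.
  set K := [predU1 x & linear u].
  (* Sending the letters outside [K] to the identity of the monoid evaluates [u] to the class of
     u(x, Lin(u)). This word is almost-linear, hence nonzero and alone in its class. *)
  pose theta z := if K z then [:: z] else [::].
  have thetaE w : seq_subst theta w = restrict K w.
    by rewrite /seq_subst /theta; elim: w => //= z w ->; case: ifP.
  have := eq_uv (fun z => \pi_(rees W_AL) (theta z)).
  rewrite /= !eval_rees => /rees_piP; rewrite !thetaE.
  case/orP=> [/eqP//|/asboolP[+ _]]; case/not_rees_ideal_W_AL.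
  have nlx z : nonlinear (restrict K u) z -> z = x.
    move=> nz; have : z \in restrict K u.
      by rewrite -has_pred1 has_count; apply: ltnW nz.
    rewrite mem_filter => /andP[/predU1P[//|/eqP lz] _].
    move: nz; rewrite /nonlinear -lz count_filter ltnNge.
    by rewrite sub_count // => t /andP[].
  by move=> y z /nlx-> /nlx->.
(* Lifting the values of [phi] to representatives turns evaluation into substitution followed by
   projection. *)
pose theta x := repr (phi x).
have phiE w : eval phi w = \pi_(rees W_AL) (seq_subst theta w).
  rewrite -eval_rees; congr eval.
  by apply: funext => x; rewrite /theta reprK.
rewrite !phiE; apply/rees_piP.
pose P s t := rees_rel W_AL (seq_subst theta s) (seq_subst theta t).
apply: (@block_balanced_swap P _ _ _ (u, v)) => //.
- by move=> s; apply: rees_rel_refl.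
- by move=> s t r; apply: rees_rel_trans.
- by move=> p s x y; apply: rees_rel_swap.
Qed.

Theorem proposition6p1 (S : monoidType) :
  let basis := delta [set sigma_1; sigma_mu; sigma_2]%classic in
  let W_AL := [set w | almost_linear w]%classic in
  (eq_theory S = [set e | block_balanced e]%classic <-> is_basis S basis) /\
  (is_basis S basis <-> equationally_equivalent S (rees W_AL)).
Proof.
move=> basis W_AL; rewrite /equationally_equivalent eq_theory_rees_W_AL.
(* With the theory of S(W_AL) known, (iii) reads as (i). *)
suff E : eq_theory S = [set e | block_balanced e]%classic <-> is_basis S basis.
  by split=> //; split=> /E.
split=> [eqS|[sub der]].
  rewrite /is_basis eqS; split; first exact: basis_block_balanced.
  by move=> u v; apply: block_balanced_derivable.
apply/seteqP; split=> [[u v] /der uv|[u v] /block_balanced_derivable uv].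
  (* S(W_AL) serves as a model: it satisfies the basis, hence all that is derivable from it, and its
     identities are block-balanced. *)
  rewrite -eq_theory_rees_W_AL; apply: derivable_sound uv.
  by rewrite eq_theory_rees_W_AL; apply: basis_block_balanced.
exact: derivable_sound sub uv.
Qed.
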